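(* Let $X$ be a topological space, let $I$ be a set, let $A\subseteq\mathcal P(I)$, and let $E=A^+$. Then the following conditions are equivalent. (1) $X$ satisfies the $E$-accumulation property. (2) For every open cover $(O_a)_{a\in A}$ of $X$, there is $i\in I$ such that $(O_a)_{i\in a\in A}$ (the subfamily indexed by those $a\in A$ with $i\in a$) is a cover of $X$. (3) $X$ is $[B,A]$-compact, for $B=\{i^<_A\mid i\in I\}$. (4) For every sequence $(x_i)_{i\in I}$ of elements of $X$, if, for each $a\in A$, we put $C_a=\overline{\{x_i\mid i\in a\}}$, then $\bigcap_{a\in A}C_a\neq\emptyset$.
   Context: $\mathcal P(I)$ is the set of all subsets of $I$; $\overline{P}$ denotes the closure of $P$ in $X$; no separation axiom is assumed; intersections of families of subsets of $X$ over an empty index set are equal to $X$. For $A\subseteq\mathcal P(I)$, $A^+=\{e\subseteq I\mid e\cap a\neq\emptyset\text{ for every }a\in A\}$. For $i\in I$, $i^<_A=\{a\in A\mid i\in a\}$. For $E\subseteq\mathcal P(I)$ and an $I$-indexed sequence $(x_i)_{i\in I}$ of elements of $X$, a point $x\in X$ is an $E$-accumulation point of the sequence if $\{i\in I\mid x_i\in U\}\in E$ for every open neighborhood $U$ of $x$. $X$ satisfies the $E$-accumulation property if every $I$-indexed sequence of elements of $X$ has some (not necessarily unique) $E$-accumulation point. For a set $A$ and $B\subseteq\mathcal P(A)$, $X$ is $[B,A]$-compact if, whenever $(O_a)_{a\in A}$ is a sequence of open sets of $X$ with $\bigcup_{a\in A}O_a=X$, there is $H\in B$ such that $\bigcup_{a\in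 H}O_a=X$. *)

(* Defs.v *)
From mathcomp Require Import all_boot.
From mathcomp Require Import boolp classical_sets filter topology.

Set Implicit Arguments.
Unset Strict Implicit.
Unset Printing Implicit Defensive.

Local Open Scope classical_set_scope.

(* A^+ *)
Definition plus_family (I : Type) (A : set (set I)) : set (set I) :=
  [set e | forall a, A a -> e `&` a !=set0].

(* i^<_A *)
Definition containing (I : Type) (A : set (set I)) (i : I) : set (set I) :=
  [set a | A a /\ a i].

Definition accumulation_point (I : Type) (X : topologicalType)
    (E : set (set I)) (x_ : I -> X) (x : X) : Prop :=
  forall U : set X, open_nbhs x U -> E [set i | U (x_ i)].

Definition accumulation_property (I : Type) (X : topologicalType)
    (E : set (set I)) : Prop :=
  forall x_ : I -> X, exists x : X, accumulation_point E x_ x.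

(* A family (O_a)_(a in A) is encoded by a total function on the ambient type
   of A; its values outside A play no role. *)
Definition open_cover (J : Type) (X : topologicalType)
    (A : set J) (O : J -> set X) : Prop :=
  (forall a, A a -> open (O a)) /\ \bigcup_(a in A) O a = [set: X].

(* [B, A]-compactness, meant for B `<=` [set H | H `<=` A]. *)
Definition BA_compact (J : Type) (X : topologicalType)
    (B : set (set J)) (A : set J) : Prop :=
  forall O : J -> set X, open_cover A O ->
    exists2 H : set J, B H & \bigcup_(a in H) O a = [set: X].

Arguments accumulation_property {I} X E.
Arguments BA_compact {J} X B A.

(* Main.v *)
Require Import Defs.
From mathcomp Require Import all_boot.
From mathcomp Require Import boolp classical_sets filter topology.

(** The theorem rests on two observations.

    Unfolding the definition of [plus_family], [x] is an accumulation point of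
    [x_] when every open neighbourhood of [x] meets every set
    [x_ @` a] with [a] in [A].  Exchanging the two quantifiers, this says that
    [x] lies in the closure of each [x_ @` a]
    ([accumulation_point_plus_familyE]); hence the accumulation property and
    the intersection property are the same.

    The covering properties are dual to these, by passing to complements.  If
    no index [i] yields a subcover, choosing for each [i] a point [x_ i] missed
    by all the [O a] with [i] in [a] gives a sequence such that [O a] is
    disjoint from [x_ @` a] for every [a] in [A]; as the [O a] cover [X], no
    point can be an accumulation point.
    Conversely, if the closures of the [x_ @` a] have no common point, their
    complements cover [X], and no subfamily indexed by the [a] containing a
    fixed [i] covers the point [x_ i]. *)

Local Open Scope classical_set_scope.

(** Both sides say that [U] meets [x_ @` a] for all open [U] around [x] and all
    [a] in [A]; they differ in which of [U] and [a] is quantified first. *)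
Lemma accumulation_point_plus_familyE (X : topologicalType) (I : Type)
    (A : set (set I)) (x_ : I -> X) (x : X) :
  accumulation_point (plus_family A) x_ x <->
  (\bigcap_(a in A) closure [set x_ i | i in a]) x.
Proof.
split=> [xacc a Aa V | xcl U oU a Aa].
- rewrite nbhsE => -[U oU UV].
  have [i [Ui ai]] := xacc U oU a Aa.
  by exists (x_ i); split; [exists i | exact: UV].
- have [_ [[i ai <-] Ui]] := xcl a Aa U (open_nbhs_nbhs oU).
  by exists i.
Qed.

(** Choosing for each [i] a point missed by the subfamily at [i] needs no point
    of [X] given beforehand: the failure of each subfamily to cover supplies
    it, so an empty [X] or [I] is no exception. *)
Lemma accumulation_property_containing_cover (X : topologicalType) (I : Type)
    (A : set (set I)) (O : set I -> set X) :
  accumulation_property X (plus_family A) -> open_cover A O ->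
  exists i : I, \bigcup_(a in containing A i) O a = [set: X].
Proof.
move=> Xacc [oO covO]; apply: contrapT => /forallNP nocov.
have /choice[x_ x_P] i : exists y, ~ (\bigcup_(a in containing A i) O a) y.
  by apply/existsNP => all_in; apply: (nocov i); apply/seteqP; split.
have [x xacc] := Xacc x_.
have [a Aa Oax] : (\bigcup_(a in A) O a) x by rewrite covO.
have [i [Oai ai]] := xacc _ (conj (oO a Aa) Oax) a Aa.
by apply: (x_P i); exists a.
Qed.

(** The complements of the closures are the worst cover for [x_]: the members
    indexed by the [a] containing [i] all miss the point [x_ i]. *)
Lemma BA_compact_bigcap_closure (X : topologicalType) (I : Type)
    (A : set (set I)) (x_ : I -> X) :
  BA_compact X [set containing A i | i in [set: I]] A ->
  \bigcap_(a in A) closure [set x_ i | i in a] !=set0.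
Proof.
move=> Xcomp; apply: contrapT => /forallNP nopt.
have [|_ [i _ <-] covi] := Xcomp (fun a => ~` closure [set x_ i | i in a]).
  split=> [a _|]; first exact/closed_openC/closed_closure.
  by rewrite -setC_bigcap; apply/seteqP; split=> // x _; exact: nopt.
have [a [_ ai] /= ncl] : (\bigcup_(a in containing A i)
    ~` closure [set x_ j | j in a]) (x_ i) by rewrite covi.
by apply: ncl; apply: subset_closure; exists i.
Qed.

Theorem theorem3p9 (X : topologicalType) (I : Type) (A : set (set I)) :
  [<-> accumulation_property X (plus_family A);
       forall O : set I -> set X, open_cover A O ->
         exists i : I, \bigcup_(a in [set a | A a /\ a i]) O a = [set: X];
       BA_compact X [set containing A i | i in [set: I]] A;
       forall x_ : I -> X,
         \bigcap_(a in A) closure [set x_ i | i in a] !=set0 ].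
Proof.
tfae.
- by move=> Xacc O; exact: accumulation_property_containing_cover.
- move=> subcov O /subcov[i covi].
  by exists (containing A i); first by exists i.
- by move=> Xcomp x_; exact: BA_compact_bigcap_closure.
- move=> meet x_; have [x xcl] := meet x_.
  by exists x; apply/accumulation_point_plus_familyE.
Qed.
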